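(* Let $r\geq 2$ be an integer and fix a graph $F\in \mathcal{GT}$. Then, as $n\to \infty$, ${\rm ex}_{r}(n, {\rm B}_{\rm ind} F) = \Theta({\rm ex}(n, F))$.
   Context: The classes $\mathcal{GT}^{(t)}$ of $t$-vertex graphs are defined inductively: $\mathcal{GT}^{(2)}=\{K_2\}$; for $t>2$, each member of $\mathcal{GT}^{(t)}$ is obtained by taking some $G'\in\mathcal{GT}^{(t-1)}$, choosing an edge $xy$ of $G'$, adding a new vertex $z\notin V(G')$ and joining $z$ to both $x$ and $y$. $\mathcal{GT}$ is the family of all non-empty subgraphs of members of $\bigcup_{t\ge 2}\mathcal{GT}^{(t)}$ (it contains, e.g., all outerplanar graphs, cycles and forests). An $r$-uniform hypergraph $\mathcal H$ is a family of $r$-element subsets (edges) of a finite vertex set $V(\mathcal H)$. For a graph $F$ with vertex set $\{v_1,\dots,v_p\}$ and edge set $\{e_1,\dots,e_q\}$, $\mathcal H$ contains an induced Berge $F$ if there exist distinct vertices $W=\{w_1,\dots,w_p\}\subseteq V(\mathcal H)$ and distinct edges $f_1,\dots,f_q$ of $\mathcal H$ such that whenever $e_i=v_\alpha v_\beta$ we have $f_i\cap W=\{w_\alpha,w_\beta\}$. ${\rm ex}_r(n,{\rm B}_{\rm ind}F)$ is the maximum number of edges of an $r$-uniform hypergraph on vertex set $[n]$ with no induced Berge $F$, and ${\rm ex}(n,F)$ is the maximum number of edges in an $n$-vertex graph with no subgraph isomorphic to $F$. Asymptotics are as $n\to\infty$ with $r,F$ fixed. *)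

(* Defs.v *)
From mathcomp Require Import all_boot all_algebra.
From mathcomp Require Import boolp classical_sets reals topology normedtype landau.

Set Implicit Arguments.
Unset Strict Implicit.
Unset Printing Implicit Defensive.

(* A hypergraph on a finite vertex type T is given by its set of edges
   H : {set {set T}}. *)
Definition uniform (r : nat) (T : finType) (H : {set {set T}}) : bool :=
  [forall e in H, #|e| == r].

(* Finite simple graphs: an edge xy is the two-element set [set x; y]. *)
Record graph := Graph {
  vertex :> finType;
  edges : {set {set vertex}};
  edges_uniform : uniform 2 edges
}.

Definition K2_edges : {set {set bool}} := [set [set: bool]].

Lemma K2_uniform : uniform 2 K2_edges.
Proof.
by apply/forall_inP => e; rewrite inE => /eqP->; rewrite cardsT card_bool.
Qed.

Definition K2 : graph := Graph K2_uniform.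

(* [option V] adjoins the new vertex [None] to V, the old vertices being the
   [Some u]. *)
Definition add_vertex_edges (G : graph) (x y : G) : {set {set option G}} :=
  [set Some @: (e : {set G}) | e in edges G]
    :|: [set [set None; Some x]; [set None; Some y]].

Lemma add_vertex_uniform (G : graph) (x y : G) :
  uniform 2 (add_vertex_edges x y).
Proof.
apply/forall_inP => e; rewrite !inE => /orP[|/orP[]].
- case/imsetP => a Ga ->; rewrite card_imset; last exact: Some_inj.
  exact: (forall_inP (edges_uniform G)).
- by move/eqP->; rewrite cards2.
- by move/eqP->; rewrite cards2.
Qed.

Definition add_vertex (G : graph) (x y : G) : graph :=
  Graph (add_vertex_uniform x y).

Inductive GTt : nat -> graph -> Prop :=
| GTt_K2 : GTt 2 K2
| GTt_add t (G : graph) (x y : G) :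
    GTt t G -> [set x; y] \in edges G -> GTt t.+1 (add_vertex x y).

(* The (not necessarily uniform) family H, seen as the edge set of a graph on T
   when [uniform 2 H], has a subgraph isomorphic to F. *)
Definition contains_subgraph (F : graph) (T : finType) (H : {set {set T}}) :
    Prop :=
  exists2 w : F -> T, injective w &
    forall e : {set F}, e \in edges F -> w @: e \in H.

(* GTt only holds of representatives of isomorphism types, so "subgraph" is
   taken up to isomorphism. Non-empty means having at least one vertex. *)
Definition GT (F : graph) : Prop :=
  0 < #|F| /\
  exists t (G : graph), GTt t G /\ contains_subgraph F (edges G).

(* W is the image of w, and f e is the hyperedge assigned to the edge e of F. *)
Definition contains_induced_Berge (F : graph) (T : finType)
    (H : {set {set T}}) : Prop :=
  exists (w : F -> T) (f : {set F} -> {set T}),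
    [/\ injective w,
        {in edges F &, injective f} &
        forall e : {set F}, e \in edges F ->
          f e \in H /\ f e :&: [set w v | v : F] = w @: e].

(* The maximum over an empty family is 0; this only occurs when F has no edge
   (then every E contains F as soon as #|F| <= n). *)
Definition ex (n : nat) (F : graph) : nat :=
  \max_(E : {set {set 'I_n}} |
        uniform 2 E && `[< ~ contains_subgraph F E >]) #|E|.

Definition ex_ind_Berge (r n : nat) (F : graph) : nat :=
  \max_(H : {set {set 'I_n}} |
        uniform r H && `[< ~ contains_induced_Berge F H >]) #|H|.

(* Main.v *)
Require Import Defs.
From mathcomp Require Import all_boot all_algebra.
From mathcomp Require Import zify.
From mathcomp Require Import boolp.

(* Upper bound. Let Q be a family of s-sets, each of the form h :&: A with h in
   H.  If s >= 3 and Q is much larger than its shadow, then Q has a subfamily in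
   which every (s-1)-set of its shadow lies in many members; in it any pair of
   vertices of a member extends to a member avoiding a prescribed small set, so
   every graph of GT can be built greedily, two edges per new vertex, and H
   contains an induced Berge F.  Otherwise choose for each S of the shadow a
   member g S of Q containing it, and a random set B: a positive proportion of
   the S satisfy g S :&: B = S, hence are traces of H on A :&: B.  Iterating down
   from s = r, A = [n] gives a graph with a positive proportion of |H| edges,
   which is F-free.

   Lower bound. Given an F-free graph E, some set S_i among three disjoint
   (r-2)-sets is disjoint from at least a third of the edges; take the
   hyperedges e :|: S_i.  A core vertex in S_i would lie on all the edges of F,
   so this works unless F is a star; then ex(n, F) = O(n), and r-sets that
   are pairwise disjoint do the job when F has two edges or more. *)

Set Implicit Arguments.
Unset Strict Implicit.
Unset Printing Implicit Defensive.

(** * Shadows, traces and cores of large codegree *)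

Definition shadow (T : finType) (s : nat) (Q : {set {set T}}) : {set {set T}} :=
  [set S : {set T} | (#|S| == s) && [exists e in Q, S \subset e]].

Definition star (T : finType) (Q : {set {set T}}) (S : {set T}) :=
  [set e in Q | S \subset e].

Definition trace (T : finType) (H : {set {set T}}) (A : {set T}) :=
  [set h :&: A | h : {set T} in H].

Definition codegree_ge (T : finType) (K s : nat) (Q : {set {set T}}) :=
  forall S, S \in shadow s Q -> K <= #|star Q S|.

Lemma uniformP (r : nat) (T : finType) (H : {set {set T}}) :
  reflect (forall e, e \in H -> #|e| = r) (uniform r H).
Proof.
apply: (iffP forall_inP) => h e eH; first exact/eqP/h.
by rewrite h.
Qed.

Lemma uniformS (r : nat) (T : finType) (H H' : {set {set T}}) :
  H' \subset H -> uniform r H -> uniform r H'.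
Proof.
by move=> /subsetP sHH /uniformP uH; apply/uniformP => e /sHH; apply: uH.
Qed.

(** Deleting the star of a shadow set with fewer than [K] members loses fewer than [K] sets of [Q]
    and at least one shadow set, so the density hypothesis survives. It also keeps the family
    non-empty when the deletions stop. *)
Lemma exists_codegree_core (T : finType) (K s : nat) (Q : {set {set T}}) :
    K * #|shadow s Q| < #|Q| ->
  exists Q' : {set {set T}},
    [/\ Q' != set0, Q' \subset Q & codegree_ge K s Q'].
Proof.
have [m] := ubnP #|Q|; elim: m Q => // m IHm Q leQm dense.
have [/forall_inP good|] := boolP [forall S in shadow s Q, K <= #|star Q S|].
  exists Q; split=> //; rewrite -card_gt0; exact: leq_trans dense.
rewrite negb_forall_in => /exists_inP[S SQ]; rewrite -ltnNge => ltSK.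
have sQ : star Q S \subset Q by apply/subsetP => e; rewrite inE => /andP[].
have cQ := cardsD Q (star Q S); rewrite (setIidPr sQ) in cQ.
have starlt : #|star Q S| <= #|Q| by apply: subset_leq_card.
have star_gt0 : 0 < #|star Q S|.
  move: SQ; rewrite inE => /andP[_ /exists_inP[e eQ Se]].
  by apply/card_gt0P; exists e; rewrite inE eQ.
have shS : shadow s (Q :\: star Q S) \subset shadow s Q :\ S.
  apply/subsetP => S'; rewrite !inE => /andP[-> /exists_inP[e]] /=.
  rewrite !inE => /andP[nSe eQ] S'e; apply/andP; split; last first.
    by apply/exists_inP; exists e.
  by apply: contraNneq nSe => <-; rewrite eQ.
have := subset_leq_card shS => shle.
rewrite [#|shadow s Q|](cardsD1 S) SQ mulnDr muln1 in dense.
have Kle : K * #|shadow s (Q :\: star Q S)| <= K * #|shadow s Q :\ S|.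
  by rewrite leq_mul2l shle orbT.
have [||Q' [Q'0 Q'Q cQ']] := IHm (Q :\: star Q S); [lia|lia|].
by exists Q'; split=> //; apply: subset_trans Q'Q (subsetDl _ _).
Qed.

(* The vertices of q in Z and outside D are exchanged one at a time. *)
Lemma codegree_avoid (T : finType) (K s : nat) (Q : {set {set T}})
    (q D Z : {set T}) :
    uniform s.+1 Q -> codegree_ge K s Q -> #|Z| < K -> q \in Q -> D \subset q ->
  exists q' : {set T}, [/\ q' \in Q, D \subset q' & q' :&: Z \subset D].
Proof.
move=> /uniformP uQ cQ ZK; have [m] := ubnP #|(q :&: Z) :\: D|.
elim: m q => // m IHm q qm qQ Dq.
have [/eqP D0|[v]] := set_0Vmem ((q :&: Z) :\: D).
  by exists q; split=> //; rewrite -setD_eq0.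
rewrite !inE => /and3P[vD vq vZ].
have cS : #|q :\ v| = s.
  by have := cardsD1 v q; rewrite vq (uQ _ qQ) => -[->].
have leK : K <= #|star Q (q :\ v)|.
  apply: cQ; rewrite inE cS eqxx; apply/exists_inP; exists q => //.
  exact: subD1set.
(* At most [#|Z| < K] supersets of [q :\ v] arise by adding a vertex of [Z], so some member of the
   star adds a vertex outside [Z]. As [v] lies in [Z], this exchange strictly shrinks the bad
   set. *)
have [e] : exists e, e \in star Q (q :\ v) :\: [set u |: (q :\ v) | u in Z].
  apply/card_gt0P; rewrite cardsD subn_gt0.
  apply: leq_ltn_trans (leq_trans ZK leK).
  apply: leq_trans (leq_imset_card (fun u => u |: (q :\ v)) (mem Z)).
  exact/subset_leq_card/subsetIr.
rewrite !inE => /andP[eZ /andP[eQ Se]].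
have [u [ue eE]] : exists u, u \notin q :\ v /\ e = u |: (q :\ v).
  have /cards1P[u uE] : #|e :\: (q :\ v)| == 1.
    by rewrite cardsD (setIidPr Se) cS (uQ _ eQ) subSnn.
  exists u; split; first by have := set11 u; rewrite -uE inE => /andP[].
  by rewrite -uE setUC -{1}(setID e (q :\ v)) (setIidPr Se).
have uZ : u \notin Z by apply: contra eZ => uZ; apply/imsetP; exists u.
have De : D \subset e.
  apply: subset_trans Se; apply/subsetP => x xD.
  by rewrite !inE (subsetP Dq) // andbT; apply: contraNneq vD => <-.
apply: (IHm e) => //; apply: leq_trans (_ : #|(q :&: Z) :\: D| <= m) => //.
apply: proper_card; apply/properP; split.
  apply/subsetP => x; rewrite eE !inE => /and3P[-> /orP[/eqP->|/andP[_ ->]]] //.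
  by rewrite (negPf uZ).
exists v; first by rewrite !inE vD vq vZ.
by rewrite eE !inE eqxx orbF vD vZ !andbT; apply: contraNneq uZ => <-.
Qed.

(** * Building graphs of GT inside a core *)

(** The invariant that every embedded edge lies in a member of [Q] drives the induction. The member
    holding the image of [xy] can be chosen to avoid all other used vertices; having at least three
    vertices, it offers a fresh one for [z], and it contains both new edges. *)
Lemma GTt_core_embedding (T : finType) (A : {set T}) (s t : nat) (K : nat)
    (Q : {set {set T}}) (G : graph) :
    GTt t G -> 2 <= s -> #|G| < K -> Q != set0 -> uniform s.+1 Q ->
    codegree_ge K s Q -> {in Q, forall q : {set T}, q \subset A} ->
  exists w : G -> T, [/\ injective w, forall v, w v \in A &
    forall e : {set G}, e \in edges G ->
      exists2 q : {set T}, q \in Q & w @: e \subset q].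
Proof.
move=> GG s2 + Q0 uQ cQ QA; have /uniformP cardQ := uQ; elim: GG => [|{}t {}G x y _ IH xyG] GK.
  have /set0Pn[q qQ] := Q0.
  have /card_gt1P[a [b [aq bq ab]]] : 1 < #|q| by rewrite cardQ // ltnS ltnW.
  exists (fun c : bool => if c then a else b); split.
  - by case=> -[] // abE; rewrite abE eqxx in ab.
  - by case; apply: (subsetP (QA _ qQ)).
  - move=> e _; exists q => //; apply/subsetP => _ /imsetP[[] _ ->] //.
have GK' : #|G| < K by apply: ltnW; move: GK; rewrite card_option.
have [w [wi wA wQ]] := IH GK'.
have [q qQ xyq] := wQ _ xyG.
have WK : #|[set w v | v : G]| < K by rewrite card_imset //.
have [q' [q'Q xyq' q'W]] := codegree_avoid uQ cQ WK qQ xyq.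
have /set0Pn[z] : q' :\: w @: [set x; y] != set0.
  rewrite -card_gt0 cardsD (setIidPr xyq') cardQ // subn_gt0 card_imset //.
  by rewrite cards2; case: (x != y); lia.
rewrite inE => /andP[zxy zq'].
have zW v : w v != z.
  apply: contraNneq zxy => wv; apply: (subsetP q'W); rewrite inE zq' -wv.
  exact: imset_f.
exists (fun o : option G => if o is Some v then w v else z); split.
- case=> [u|] [v|] //; first by move/wi ->.
    by move/eqP; rewrite (negPf (zW _)).
  by move/esym/eqP; rewrite (negPf (zW _)).
- by case=> // ; apply: (subsetP (QA _ q'Q)).
move=> e; rewrite !inE => /orP[/imsetP[e' e'G ->]|].
  have [q1 q1Q e'q1] := wQ _ e'G; exists q1 => //.
  by rewrite -imset_comp.
have xq' : w x \in q' by apply/(subsetP xyq')/imset_f; rewrite !inE eqxx.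
have yq' : w y \in q' by apply/(subsetP xyq')/imset_f; rewrite !inE eqxx orbT.
case/orP=> /eqP->; exists q' => //; rewrite imsetU1 imset_set1 subUset !sub1set;
  by rewrite zq' ?xq' ?yq'.
Qed.

(** Once all core vertices [W] are placed, each edge gets a member of [Q] meeting [W] only in that
    edge. Since [W] lies in [A], a hyperedge whose trace on [A] is this member meets [W] in the same
    set. Distinct edges then have distinct hyperedges, as these differ on [W]. *)
Lemma core_induced_Berge (T : finType) (H : {set {set T}}) (A : {set T})
    (s t K : nat) (Q : {set {set T}}) (F G : graph) :
    GTt t G -> contains_subgraph F (edges G) -> 2 <= s -> #|G| < K ->
    Q \subset trace H A -> Q != set0 -> uniform s.+1 Q -> codegree_ge K s Q ->
  contains_induced_Berge F H.
Proof.
move=> GG [w0 w0i w0e] s2 GK QH Q0 uQ cQ.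
have QA : {in Q, forall q : {set T}, q \subset A}.
  by move=> q /(subsetP QH)/imsetP[h _ ->]; apply: subsetIr.
have [w1 [w1i w1A w1Q]] := GTt_core_embedding GG s2 GK Q0 uQ cQ QA.
pose w v := w1 (w0 v); pose W := [set w v | v : F].
have wi : injective w by apply: inj_comp.
have WA : W \subset A by apply/subsetP => _ /imsetP[v _ ->]; apply: w1A.
have WK : #|W| < K.
  rewrite card_imset //; apply: leq_ltn_trans GK; exact: leq_card w0i.
have /choice[f fP] : forall e : {set F}, exists h : {set T},
    e \in edges F -> h \in H /\ h :&: W = w @: e.
  move=> e; have [/w0e/w1Q[q qQ]|_] := boolP (e \in edges F); last first.
    by exists set0.
  rewrite -imset_comp -[_ \o _]/w => eq.
  have [q' [q'Q eq' q'W]] := codegree_avoid uQ cQ WK qQ eq.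
  have /imsetP[h hH q'E] := subsetP QH _ q'Q.
  exists h => _; split=> //; apply/eqP; rewrite eqEsubset; apply/andP; split.
    by apply: subset_trans q'W; rewrite q'E -setIA (setIidPr WA).
  rewrite subsetI (subset_trans eq') ?q'E ?subsetIl //=.
  by apply/subsetP => _ /imsetP[v _ ->]; apply: imset_f.
exists w, f; split=> // e e' /fP[_ eE] /fP[_ e'E] ff.
by apply: (imset_inj wi); rewrite -eE -e'E ff.
Qed.

(** * Descent from large sets to pairs through traces *)

(** For a fixed [S] of the shadow, a uniformly random [B] satisfies [g S :&: B = S] with probability
    [2 ^- s.+1], so some [B] does at least as well as the average. *)
Lemma trace_shadow_sample (T : finType) (s : nat) (H Q : {set {set T}})
    (A : {set T}) :
    uniform s.+1 Q -> Q \subset trace H A ->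
  exists (A' : {set T}) (R : {set {set T}}),
    [/\ uniform s R, R \subset trace H A' & #|shadow s Q| <= 2 ^ s.+1 * #|R|].
Proof.
move=> /uniformP uQ QH.
pose g (S : {set T}) := odflt set0 [pick e : {set T} in Q | S \subset e].
have gP S : S \in shadow s Q -> [/\ #|S| = s, g S \in Q & S \subset g S].
  rewrite inE /g => /andP[/eqP-> /exists_inP[e eQ Se]].
  by case: pickP => [h /andP[]//|/(_ e)]; rewrite eQ Se.
pose R (B : {set T}) := [set S in shadow s Q | g S :&: B == S].
have [B BP] : exists B, #|shadow s Q| <= 2 ^ s.+1 * #|R B|.
  apply/existsP; apply: contraT; rewrite negb_exists => /forallP few.
  (* If every [B] failed, each term would fall short by at least 1; summing over the non-empty
     collection of all [B] contradicts the double count below. *)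
  have : \sum_(B : {set T}) (2 ^ s.+1 * #|R B|).+1
       <= \sum_(B : {set T}) #|shadow s Q|.
    by apply: leq_sum => B _; rewrite ltnNge.
  rewrite leqNgt => /negP[]; rewrite sum_nat_const.
  under [ltnRHS]eq_bigr do rewrite -addn1.
  rewrite big_split /= sum_nat_const muln1 -big_distrr /=.
  rewrite -addn1; apply: leq_add; last first.
    by apply/card_gt0P; exists set0.
  have -> : \sum_(B : {set T}) #|R B|
          = \sum_(S in shadow s Q) #|[set B | g S :&: B == S]|.
    have -> : \sum_B #|R B| = \sum_B \sum_S (S \in R B).
      apply: eq_bigr => B _; rewrite -sum1_card big_mkcond.
      by apply: eq_bigr => S _; case: (S \in R B).
    rewrite exchange_big /= [RHS]big_mkcond; apply: eq_bigr => S _.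
    case: (boolP (S \in shadow s Q)) => SQ; last first.
      by rewrite big1 // => B _; rewrite in_set (negPf SQ).
    rewrite -sum1_card [RHS]big_mkcond; apply: eq_bigr => B _.
    by rewrite [S \in R B]in_set SQ in_set; case: (_ == _).
  rewrite mulnC -sum_nat_const big_distrr /=; apply: leq_sum => S /gP[cS gQ Sg].
  (* The sets [S :|: D] with [D] disjoint from [g S] are distinct good choices of [B]. *)
  have -> : #|{set T}| = 2 ^ s.+1 * #|powerset (~: g S)|.
    rewrite -cardsT -powersetT !card_powerset cardsT -expnD.
    by rewrite -(uQ _ gQ) cardsC.
  rewrite leq_mul2l; apply/orP; right.
  rewrite -(card_in_imset (f := fun D => S :|: D)).
    apply/subset_leq_card/subsetP => _ /imsetP[D + ->]; rewrite !inE => DS.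
    rewrite setIUr (setIidPr Sg) (_ : g S :&: D = set0) ?setU0 //.
    by apply/disjoint_setI0; rewrite disjoint_sym disjoints_subset.
  move=> D D'; rewrite !inE => DS DS' /(congr1 (fun X => X :&: ~: g S)).
  rewrite !setIUl (setIidPl DS) (setIidPl DS') -setDE.
  by move: Sg; rewrite -setD_eq0 => /eqP->; rewrite !set0U.
exists (A :&: B), (R B); split=> //.
  by apply/uniformP => S; rewrite inE => /andP[/gP[]].
apply/subsetP => S; rewrite inE => /andP[/gP[_ gQ _] /eqP SE].
have /imsetP[h hH gE] := subsetP QH _ gQ.
by apply/imsetP; exists h => //; rewrite setIA -gE.
Qed.

(** Each descent by one in uniformity costs [#|G|.+1], since a denser family would have a core and
    hence an induced Berge [F], and at most [2 ^ r] for the sampling. The set [A] is quantified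
    inside because sampling shrinks it. *)
Lemma trace_card_bound (T : finType) (H : {set {set T}}) (F G : graph)
    (t N r : nat) :
    GTt t G -> contains_subgraph F (edges G) -> ~ contains_induced_Berge F H ->
    (forall (A : {set T}) (Q : {set {set T}}),
      uniform 2 Q -> Q \subset trace H A -> #|Q| <= N) ->
  forall k (A : {set T}) (Q : {set {set T}}), k.+2 <= r ->
    uniform k.+2 Q -> Q \subset trace H A ->
    #|Q| <= (#|G|.+1 * 2 ^ r) ^ k * N.
Proof.
move=> GG FG noF base; elim=> [|k IH] A Q kr uQ QH.
  by rewrite expn0 mul1n; apply: base QH.
have shle : #|Q| <= #|G|.+1 * #|shadow k.+2 Q|.
  rewrite leqNgt; apply/negP => /exists_codegree_core[Q' [Q'0 Q'Q cQ']].
  apply: noF; apply: (core_induced_Berge GG FG _ _ _ Q'0 _ cQ') => //.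
  - exact: subset_trans QH.
  - exact: uniformS uQ.
have [A' [R [uR RH shR]]] := trace_shadow_sample uQ QH.
apply: leq_trans shle _; rewrite expnS -!mulnA leq_mul2l /=.
apply: leq_trans shR _; apply: leq_mul; first by rewrite leq_exp2l.
by apply: IH uR RH; apply: ltnW.
Qed.

(** * Placing the isolated vertices of F *)

Lemma leq_card_bigcup (I T : finType) (P : pred I) (X : I -> {set T}) :
  #|\bigcup_(i | P i) X i| <= \sum_(i | P i) #|X i|.
Proof.
elim/big_rec2: _ => [|i m B _ mB]; first by rewrite cards0.
by apply: leq_trans (leq_card_setU _ _) _; rewrite leq_add2l.
Qed.

Lemma exists_injection_into (F T : finType) (B : {set T}) :
  #|F| <= #|B| -> exists i : F -> T, injective i /\ forall v, i v \in B.
Proof.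
move=> leFB; exists (fun v => enum_val (widen_ord leFB (enum_rank v))); split.
  by move=> u v /enum_val_inj/(congr1 val)/=/val_inj/enum_rank_inj.
by move=> v; apply: enum_valP.
Qed.

(* For T large, the isolated vertices of F can be sent outside every hyperedge
   in use, so only the vertices lying on an edge of F matter. *)
Lemma induced_Berge_of_support (F : graph) (T : finType) (r : nat)
    (H : {set {set T}}) (w : F -> T) (f : {set F} -> {set T}) :
    uniform r H -> #|F| + (#|F| + #|edges F| * r) <= #|T| ->
    {in cover (edges F) &, injective w} ->
    (forall e, e \in edges F ->
       f e \in H /\ f e :&: w @: cover (edges F) = w @: e) ->
  contains_induced_Berge F H.
Proof.
move=> /uniformP uH; set U := cover (edges F) => Tbig wi fP.
pose Y := w @: U :|: \bigcup_(e in edges F) f e.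
have cY : #|Y| <= #|F| + #|edges F| * r.
  apply: leq_trans (leq_card_setU _ _) _; apply: leq_add.
    by apply: leq_trans (leq_imset_card _ _) (max_card _).
  apply: leq_trans (leq_card_bigcup _ _) _; rewrite -sum_nat_const.
  by apply: leq_sum => e /fP[/uH->].
have [|i [ii iY]] := @exists_injection_into F T (~: Y).
  by rewrite -(cardsC Y) in Tbig; lia.
have sU e v : e \in edges F -> v \in e -> v \in U.
  by move=> eF ve; apply/bigcupP; exists e.
pose w' v := if v \in U then w v else i v.
have iN v u : u \in U -> i v <> w u.
  move=> uU ivE; have := iY v; rewrite !inE ivE negb_or => /andP[/negP[]].
  exact: imset_f.
have w'i : injective w'.
  move=> u v; rewrite /w'; case: ifP => uU; case: ifP => vU.
  - exact: wi.
  - by move/esym/(iN v u uU).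
  - by move/(iN u v vU).
  - exact: ii.
have fW e : e \in edges F -> f e :&: [set w' v | v : F] = w' @: e.
  move=> eF; have [_ feE] := fP e eF.
  have -> : w' @: e = w @: e.
    by apply: eq_in_imset => v ve; rewrite /w' (sU e).
  apply/setP => x; apply/idP/idP; last first.
    move=> xe; have := xe; rewrite -feE !inE => /andP[-> _] /=.
    have /imsetP[v ve ->] := xe; apply/imsetP; exists v => //.
    by rewrite /w' (sU e).
  rewrite inE => /andP[xf /imsetP[v _ xE]].
  move: xE; rewrite /w'; case: ifP => vU xE.
    by rewrite -feE inE xf xE imset_f.
  have := iY v; rewrite -xE !inE negb_or => /andP[_ /bigcupP[]].
  by exists e.
exists w', f; split=> // [e e' eF e'F ff|e eF].
  by apply: (imset_inj w'i); rewrite -!fW // ff.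
by split; [case: (fP e eF)|apply: fW].
Qed.

(** * The upper bound *)

Lemma card_le_ex (n : nat) (F : graph) (E : {set {set 'I_n}}) :
  uniform 2 E -> ~ contains_subgraph F E -> #|E| <= ex n F.
Proof.
move=> uE noF; apply: (@leq_bigmax_cond _ _ (fun E : {set {set 'I_n}} => #|E|)).
by rewrite uE; apply/asboolP.
Qed.

Lemma card_le_ex_ind_Berge (r n : nat) (F : graph) (H : {set {set 'I_n}}) :
  uniform r H -> ~ contains_induced_Berge F H -> #|H| <= ex_ind_Berge r n F.
Proof.
move=> uH noF; apply: (@leq_bigmax_cond _ _ (fun E : {set {set 'I_n}} => #|E|)).
by rewrite uH; apply/asboolP.
Qed.

Lemma ex_ind_Berge_le (r : nat) (F : graph) : 2 <= r -> GT F ->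
  exists C n0, forall n, n0 <= n -> ex_ind_Berge r n F <= C * ex n F.
Proof.
move=> r2 [_ [t [G [GG FG]]]].
(* There are [r.-2] descents from [r]-sets to pairs; the threshold on [n] is that of
   [induced_Berge_of_support]. *)
exists ((#|G|.+1 * 2 ^ r) ^ r.-2), (#|F| + (#|F| + #|edges F| * r)) => n nbig.
apply/bigmax_leqP => H /andP[uH /asboolP noF].
have rE : r.-2.+2 = r by lia.
apply: (@trace_card_bound _ _ _ _ _ _ r GG FG noF _ r.-2 [set: 'I_n] H).
(* A copy of [F] in a graph of traces lifts to hyperedges. Isolated vertices of the copy may lie
   outside [A] and inside these hyperedges, so only the vertices on edges, which do lie in [A], are
   kept. *)
- move=> A Q uQ QH; apply: card_le_ex => // -[w wi wQ]; apply: noF.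
  have /choice[f fP] : forall e : {set F}, exists h : {set 'I_n},
      e \in edges F -> h \in H /\ h :&: A = w @: e.
    move=> e; have [/wQ/(subsetP QH)/imsetP[h hH ->]|_] := boolP (e \in edges F).
      by exists h.
    by exists set0.
  apply: (induced_Berge_of_support (w := w) (f := f) uH) => //.
  + by rewrite card_ord.
  + by move=> u v _ _; apply: wi.
  move=> e eF; have [fH fE] := fP e eF; split=> //.
  have UA : w @: cover (edges F) \subset A.
    apply/subsetP => _ /imsetP[v /bigcupP[e' e'F ve'] ->].
    have [_ fE'] := fP e' e'F.
    by have := imset_f w ve'; rewrite -fE' inE => /andP[].
  rewrite -(setIidPr UA) setIA fE; apply/setIidPl/imsetS.
  by apply/subsetP => v ve; apply/bigcupP; exists e.
- by rewrite rE.
- by rewrite rE.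
by apply/subsetP => h hH; apply/imsetP; exists h; rewrite ?setIT.
Qed.

(** * The lower bound *)

Lemma subgraph_of_induced_Berge (F : graph) (T : finType) (E : {set {set T}}) :
  uniform 2 E -> contains_induced_Berge F E -> contains_subgraph F E.
Proof.
move=> /uniformP uE [w [f [wi _ fP]]]; exists w => // e eF.
have [fE fW] := fP e eF; have /uniformP uF := edges_uniform F.
suff <- : f e = w @: e by [].
apply/eqP; rewrite eq_sym eqEcard -fW subsetIl /= fW card_imset //.
by rewrite uE // uF.
Qed.

(** This settles the stars with at most one edge, which pairwise disjoint hyperedges cannot avoid:
    for large [n], a single edge of [E] already yields [F]. *)
Lemma ex_le1_edge (F : graph) (n : nat) :
  #|edges F| <= 1 -> #|F| + (#|F| + #|edges F| * 2) <= n -> ex n F = 0.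
Proof.
move=> F1 nbig; apply/eqP; rewrite -leqn0; apply/bigmax_leqP => E.
move=> /andP[uE /asboolP noF]; rewrite leqn0 cards_eq0.
apply/negPn/negP => /set0Pn[e eE]; apply: noF.
have /uniformP uF := edges_uniform F.
have /cards2P[x [y [xy eE']]] : #|e| == 2 by rewrite (uniformP _ _ uE).
apply: subgraph_of_induced_Berge => //.
have [F0|/set0Pn[a aF]] := eqVneq (edges F) set0.
  apply: (induced_Berge_of_support (w := fun=> x) (f := fun=> e) uE) => //.
  - by rewrite card_ord.
  - by move=> u v; rewrite F0 /cover big_set0 inE.
  - by move=> a; rewrite F0 inE.
have Fa : edges F = [set a].
  apply/esym/eqP; rewrite eqEcard sub1set aF cards1; lia.
have /cards2P[c [d [cd aE]]] : #|a| == 2 by rewrite uF.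
pose w v := if v == c then x else y.
have wa : w @: a = e.
  by rewrite aE imsetU1 imset_set1 /w eqxx eq_sym (negPf cd).
have cF : cover (edges F) = a by rewrite Fa /cover big_set1.
apply: (induced_Berge_of_support (w := w) (f := fun=> e) uE) => //.
- by rewrite card_ord.
- rewrite cF => u v ua va wuv; apply: (imset_injP _ _ _ ua va wuv).
  by rewrite wa aE eE' !cards2 cd xy.
- by move=> b; rewrite Fa inE => /eqP->; rewrite -Fa cF wa setIid.
Qed.

(** A vertex with more than [#|F|] neighbours could serve as the centre [c], the other vertices of
    [F] going to distinct neighbours; so all degrees in an [F]-free graph are at most [#|F|]. *)
Lemma ex_star_le (F : graph) (c : F) (n : nat) :
  (forall e, e \in edges F -> c \in e) -> ex n F <= n * #|F|.
Proof.
move=> cF; apply/bigmax_leqP => E /andP[/uniformP uE /asboolP noF].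
pose N v := [set u | [set v; u] \in E].
have Nlt v : #|N v| <= #|F|.
  rewrite leqNgt; apply/negP => /ltnW/exists_injection_into[i [ii iN]].
  have iv u : i u != v.
    apply/negP => /eqP iu; have := iN u; rewrite inE iu setUid => /uE.
    by rewrite cards1.
  apply: noF; exists (fun u => if u == c then v else i u).
    move=> a b; case: eqP => [->|_]; case: eqP => [->|_] //.
    - by move/esym/eqP; rewrite (negPf (iv _)).
    - by move/eqP; rewrite (negPf (iv _)).
    - exact: ii.
  move=> e eF; have ce := cF e eF.
  have /cards1P[d dE] : #|e :\ c| == 1.
    have /uniformP/(_ e eF) := edges_uniform F.
    by rewrite (cardsD1 c) ce add1n => -[->].
  have : d \in e :\ c by rewrite dE inE.
  rewrite !inE => /andP[dc _]; rewrite -(setD1K ce) dE imsetU1 imset_set1.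
  by rewrite eqxx (negPf dc); have := iN d; rewrite inE.
have sE : E \subset \bigcup_v [set [set v; u] | u in N v].
  apply/subsetP => e eE.
  have /cards2P[x [y [xy eE']]] : #|e| == 2 by rewrite uE.
  apply/bigcupP; exists x => //; apply/imsetP; exists y => //.
  by rewrite inE -eE'.
apply: leq_trans (subset_leq_card sE) _.
apply: leq_trans (leq_card_bigcup _ _) _.
rewrite -[n in leqRHS]card_ord -sum_nat_const; apply: leq_sum => v _.
exact: leq_trans (leq_imset_card _ _) (Nlt v).
Qed.

(** Disjoint intervals with two uses: hyperedges when [k = r], and the three sets added to graph
    edges when [k = r - 2]. *)
Definition block (n k i : nat) : {set 'I_n} :=
  [set x : 'I_n | i * k <= x < i.+1 * k].

Lemma card_block (n k i : nat) : i.+1 * k <= n -> #|block n k i| = k.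
Proof.
move=> leikn; rewrite -sum1_card.
rewrite (eq_bigl (fun x : 'I_n => (i * k <= x) && (x < i.+1 * k))); last first.
  by move=> x; rewrite inE.
rewrite -(big_mkord (fun x => (i * k <= x) && (x < i.+1 * k)) (fun=> 1)).
rewrite -(big_nat_widen _ _ _ (fun x => i * k <= x)) //.
rewrite -(big_nat_widenl (i * k) 0 _ predT) //.
by rewrite sum_nat_const_nat muln1 mulSn addnK.
Qed.

Lemma block_inj (n k i j : nat) (x : 'I_n) :
  x \in block n k i -> x \in block n k j -> i = j.
Proof. rewrite !inE; nia. Qed.

(** The hyperedges of two edges of [F] would both contain the image of the centre, hence coincide
    among disjoint blocks. *)
Lemma ex_ind_Berge_star_ge (r n : nat) (F : graph) (c : F) :
  0 < r -> (forall e, e \in edges F -> c \in e) -> 1 < #|edges F| ->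
  n %/ r <= ex_ind_Berge r n F.
Proof.
move=> r0 cF /card_gt1P[e1 [e2 [e1F e2F e12]]].
pose H := [set block n r i | i : 'I_(n %/ r)].
have le_r (i : 'I_(n %/ r)) : i.+1 * r <= n.
  by apply: leq_trans (leq_divM n r); rewrite leq_mul2r ltn_ord orbT.
have bi : injective (fun i : 'I_(n %/ r) => block n r i).
  move=> i j bij; apply/val_inj.
  have /card_gt0P[x xi] : 0 < #|block n r i| by rewrite card_block.
  by apply: (block_inj xi); rewrite -bij.
rewrite -[leqLHS]card_ord -(card_imset _ bi); apply: card_le_ex_ind_Berge.
  by apply/uniformP => _ /imsetP[i _ ->]; rewrite card_block.
move=> [w [f [wi fi fP]]].
have wf e : e \in edges F -> exists2 i : 'I_(n %/ r),
    f e = block n r i & w c \in block n r i.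
  move=> eF; have [/imsetP[i _ fE] fW] := fP e eF; exists i => //.
  by have := imset_f w (cF e eF); rewrite -fW fE inE => /andP[].
have [i1 f1 w1] := wf _ e1F; have [i2 f2 w2] := wf _ e2F.
move/eqP: e12; apply; apply: fi => //.
by rewrite f1 f2 (block_inj w1 w2).
Qed.

Lemma ex_le_ind_Berge_nonstar (r n : nat) (F : graph) :
    2 <= r -> 3 * (r - 2) <= n ->
    (forall v : F, exists2 e : {set F}, e \in edges F & v \notin e) ->
  ex n F <= 3 * ex_ind_Berge r n F.
Proof.
move=> r2 nbig nostar; apply/bigmax_leqP => E /andP[/uniformP uE /asboolP noF].
pose S (i : 'I_3) := block n (r - 2) i.
pose E_ i := [set e in E | [disjoint e & S i]].
have cS i : #|S i| = r - 2.
  by rewrite card_block //; apply: leq_trans nbig; rewrite leq_mul2r ltn_ord orbT.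
have leE i : #|E_ i| <= ex_ind_Berge r n F.
  have inj : {in E_ i &, injective (fun e => e :|: S i)}.
    move=> e e'; rewrite !inE => /andP[_ eS] /andP[_ e'S].
    move/(congr1 (fun X => X :\: S i)); rewrite !setDUl setDv !setU0.
    by rewrite (setDidPl eS) (setDidPl e'S).
  rewrite -(card_in_imset inj); apply: card_le_ex_ind_Berge.
    apply/uniformP => _ /imsetP[e + ->]; rewrite inE => /andP[eE eS].
    by rewrite cardsU (disjoint_setI0 eS) cards0 subn0 uE // cS subnKC.
  move=> [w [f [wi _ fP]]]; apply: noF; exists w => // e eF.
  have WS v : w v \notin S i.
    apply/negP => vS; have [e' e'F ve'] := nostar v.
    have [/imsetP[e0 _ fE] fW] := fP _ e'F.
    case/negP: ve'; rewrite -(mem_imset _ _ wi) -fW inE fE inE vS orbT.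
    exact: imset_f.
  have [/imsetP[e0 + fE] fW] := fP _ eF; rewrite inE => /andP[e0E _].
  have we0 : w @: e \subset e0.
    apply/subsetP => x xe; have := xe; rewrite -fW fE => /setIP[/setUP[//|xS] _].
    by have /imsetP[v _ xE] := xe; have := WS v; rewrite -xE xS.
  suff -> : w @: e = e0 by [].
  have /uniformP uF := edges_uniform F.
  by apply/eqP; rewrite eqEcard we0 card_imset // uE // uF.
have sE : E \subset \bigcup_i E_ i.
  apply/subsetP => e eE; apply: contraT => ne.
  (* An edge outside every [E_ i] would meet three disjoint blocks, which needs three vertices. *)
  have hit i : exists x, (x \in e) && (x \in S i).
    apply/existsP; apply: contraNT ne; rewrite negb_exists => /forallP dis.
    apply/bigcupP; exists i => //; rewrite inE eE.
    rewrite disjoint_subset; apply/subsetP => x xe.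
    by have := dis x; rewrite xe.
  have [p pP] := choice hit.
  have : #|[set p i | i : 'I_3]| <= #|e|.
    by apply/subset_leq_card/subsetP => _ /imsetP[i _ ->]; have /andP[] := pP i.
  rewrite (uE e eE) card_imset ?card_ord // => i j pij; apply/val_inj.
  have /andP[_ pi] := pP i; have /andP[_ pj] := pP j.
  by apply: (block_inj pi); rewrite pij.
apply: leq_trans (subset_leq_card sE) _.
apply: leq_trans (leq_card_bigcup _ _) _.
rewrite -[3 in leqRHS](card_ord 3) -sum_nat_const.
exact: leq_sum.
Qed.

Lemma ex_le_ind_Berge (r : nat) (F : graph) : 2 <= r ->
  exists C n0, forall n, n0 <= n -> ex n F <= C * ex_ind_Berge r n F.
Proof.
move=> r2.
have [/existsP[c /forall_inP cF]|] :=
  boolP [exists c : F, forall e in edges F, c \in e]; last first.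
  rewrite negb_exists => /forallP nostar.
  exists 3, (3 * (r - 2)) => n nbig; apply: ex_le_ind_Berge_nonstar => // v.
  by have := nostar v; rewrite negb_forall_in => /exists_inP.
have [F1|F2] := leqP #|edges F| 1.
  by exists 0, (#|F| + (#|F| + #|edges F| * 2)) => n /(ex_le1_edge F1) ->.
(* For [n >= r], the remainder is below [r <= n %/ r * r], so [n <= 2 * r * (n %/ r)]. *)
exists (2 * r * #|F|), r => n rn.
apply: leq_trans (ex_star_le n cF) _.
rewrite mulnAC leq_mul2r; apply/orP; right.
have := ex_ind_Berge_star_ge n (ltnW r2) cF F2.
have q1 : 0 < n %/ r by rewrite divn_gt0 // ltnW.
have := divn_eq n r; have := ltn_pmod n (ltnW r2); nia.
Qed.

(* Imported only here because classical_sets shadows the names of finset. *)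
From mathcomp Require Import classical_sets reals topology normedtype landau.

Import GRing.Theory Num.Theory.

Local Open Scope classical_set_scope.
Local Open Scope ring_scope.

Theorem theorem2p2 (R : realType) (r : nat) (hr : (2 <= r)%N)
    (F : graph) (hF : GT F) :
  (fun n : nat => (ex_ind_Berge r n F)%:R : R^o)
    =Theta_\oo (fun n : nat => (ex n F)%:R : R^o).
Proof.
have eqO (a b : nat -> nat) :
    (exists C n0, forall n, (n0 <= n)%N -> (a n <= C * b n)%N) ->
    (fun n : nat => (a n)%:R : R^o) =O_\oo (fun n : nat => (b n)%:R : R^o).
  (* The constant must be positive, while [C] may be 0. *)
  move=> [C [n0 ab]]; apply/eqO_exP; exists C.+1%:R; first by rewrite ltr0n.
  near=> n; rewrite !normr_nat -natrM ler_nat.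
  apply: leq_trans (ab n _) _; first by near: n; exists n0.
  by rewrite leq_mul2r leqnSn orbT.
rewrite eqThetaE bigThetaE; split; last rewrite eqOmegaO; apply: eqO.
- exact: ex_ind_Berge_le.
- exact: ex_le_ind_Berge.
Unshelve. all: by end_near.
Qed.
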